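(* Let $D$ be a semicomplete digraph, let $uv\in A(D)$ be arbitrary and let $D'=D\setminus\{uv\}$ be obtained from $D$ by deleting the arc $uv$. If $D'$ is strong, then $D'$ contains a spanning eulerian subdigraph if and only if $V(D')$ cannot be partitioned into $R_1$, $R_2$ and $Y=\{u,v\}$ such that $Y$ is independent in $D'$, $d(R_2,Y)=0$, $d(Y,R_1)=0$ and $d(R_2,R_1)=1$, where $d(X,Z)$ denotes the number of arcs of $D'$ from $X$ to $Z$.
   Context: Digraphs are finite, with no loops and no parallel arcs (two opposite arcs are allowed). A digraph is semicomplete if it has no pair of non-adjacent vertices. A digraph is strong if it has an $(s,t)$-path for each ordered pair of distinct vertices $s,t$. A set of vertices is independent if its vertices are pairwise non-adjacent. A digraph is eulerian if it is connected and every vertex has in-degree equal to out-degree; a subdigraph is spanning if it contains all vertices. *)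

(* Defs.v *)
From mathcomp Require Import all_boot.

Set Implicit Arguments.
Unset Strict Implicit.
Unset Printing Implicit Defensive.

(* A digraph on the finite vertex set T is an irreflexive e : rel T, with
   e x y meaning that xy is an arc: there are no loops and no parallel arcs,
   but xy and yx may both be arcs. *)
Section Digraph.
Variable T : finType.
Implicit Types (e h : rel T) (u v x y : T) (X Z : {set T}).

Definition adjacent e : rel T := [rel x y | e x y || e y x].

Definition semicomplete e : Prop := forall x y, x != y -> adjacent e x y.

Definition del_arc e u v : rel T := [rel x y | e x y && ((x, y) != (u, v))].

Definition strong e : Prop := forall s t, s != t -> connect e s t.

(* Connectedness is that of the underlying undirected graph. *)
Definition connected e : Prop := forall x y, connect (adjacent e) x y.

Definition independent e X : Prop :=
  {in X &, forall x y, x != y -> ~~ adjacent e x y}.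

Definition outdeg e x : nat := #|[set y | e x y]|.
Definition indeg e x : nat := #|[set y | e y x]|.

Definition eulerian e : Prop :=
  connected e /\ forall x, indeg e x = outdeg e x.

(* A spanning subdigraph of e has vertex set T, hence is given by its arcs. *)
Definition has_spanning_eulerian e : Prop :=
  exists h, subrel h e /\ eulerian h.

Definition arcs_between e X Z : nat :=
  #|[set a : T * T | [&& a.1 \in X, a.2 \in Z & e a.1 a.2]]|.

(* Empty parts are allowed. *)
Definition partition3 (A B C : {set T}) : Prop :=
  [/\ [disjoint A & B], [disjoint A & C], [disjoint B & C]
    & A :|: B :|: C = [set: T]].

End Digraph.

(* Main.v *)
(* Write e for D' = D \ uv; D' is semicomplete away from v. By a Camion-type
   argument either D' is hamiltonian or D' - v has a hamiltonian cycle C.  In the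
   latter case, with u and v non-adjacent in D', cut C open at u.  If v cannot be
   inserted in C, and no detour of C through v (possibly repeating a vertex but no
   arc) is available, then along C all out-neighbours of v come before all its
   in-neighbours, u receives no arc from the former and sends none to the latter,
   and the only arc from the former to the latter is the one lying on C: this is
   the partition with R2 = N+(v) and R1 = N-(v).  Conversely, an eulerian
   subdigraph would have to enter R2 from both u and v, but can leave it only once. *)
Require Import Defs.
From mathcomp Require Import all_boot.
From Stdlib Require Import Classical_Prop.

Set Implicit Arguments.
Unset Strict Implicit.
Unset Printing Implicit Defensive.

(** * Hamiltonian cycles of strong semicomplete digraphs: Camion's theorem *)

Section HamiltonianCycles.
Variable T : finType.
Implicit Types (e r : rel T) (A : {set T}) (v x y : T) (p q s : seq T).

Definition within A e := [rel x y | [&& x \in A, y \in A & e x y]].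

Definition strong_on A e := {in A &, forall x y, connect (within A e) x y}.

Definition hamiltonian A e := exists s, [/\ uniq s, s =i A & cycle e s].

Lemma connect_invariant e (P : T -> Prop) x y :
  P x -> (forall z w, P z -> e z w -> P w) -> connect e x y -> P y.
Proof.
move=> Px Pe /connectP[p]; elim: p x Px => [|z p IHp] x Px /=; first by move=> _ ->.
by case/andP=> /(Pe _ _ Px)/IHp.
Qed.

(** Among the out-neighbours of [v] in [A], take [a] with the largest reach inside [A]. Any [w] is
    reached from some out-neighbour [b]; an arc from [a] to [b] settles it, and an arc from [b] to
    [a] makes the reach of [b] contain that of [a], hence equal it by maximality. *)
Lemma out_neighbour_to_all e A v :
    v \notin A -> A != set0 -> {in A &, total e} ->
    {in A, forall w, connect (within (v |: A) e) v w} ->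
  exists a, [/\ a \in A, e v a & {in A, forall w, connect (within A e) a w}].
Proof.
move=> vA /set0Pn[w0 Aw0] totA conn_v.
have from_nbr w : w \in A ->
    exists a, [/\ a \in A, e v a & connect (within A e) a w].
  move=> Aw; move: (Aw); apply: (connect_invariant (P := fun w => w \in A ->
      exists a, [/\ a \in A, e v a & connect (within A e) a w])) (conn_v w Aw).
    by rewrite (negPf vA).
  move=> y z IHy /and3P[]; rewrite !in_setU1 => vAy _ eyz Az.
  have [eyv|nyv] := eqVneq y v; first by exists z; rewrite -eyv.
  move: vAy; rewrite (negPf nyv) /= => Ay; have [a [Aa eva aw]] := IHy Ay.
  exists a; split=> //; apply: connect_trans aw (connect1 _).
  by rewrite /= Ay Az.
have [a0 [Aa0 eva0 _]] := from_nbr w0 Aw0.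
pose P := [pred a | (a \in A) && e v a].
have Pa0 : P a0 by rewrite /= Aa0.
have [a /andP[Aa eva] maxa] := arg_maxnP (fun a => #|connect (within A e) a|) Pa0.
exists a; split=> // w Aw; have [b [Ab evb bw]] := from_nbr w Aw.
case/orP: (totA a b Aa Ab) => [eab|eba].
  by apply: connect_trans bw; apply: connect1; rewrite /= Aa Ab.
have sub_ab : connect (within A e) a \subset connect (within A e) b.
  apply/subsetP=> z az; apply: connect_trans az; apply: connect1.
  by rewrite /= Aa Ab.
have Pb : P b by rewrite /= Ab.
have card_ab : #|connect (within A e) a| = #|connect (within A e) b|.
  by apply/eqP; rewrite eqn_leq subset_leq_card //=; apply: maxa.
by rewrite -[connect _ a w]/(w \in connect _ a) (subset_cardP card_ab sub_ab).
Qed.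

Lemma in_neighbour_from_all e A v :
    v \notin A -> A != set0 -> {in A &, total e} ->
    {in A, forall w, connect (within (v |: A) e) w v} ->
  exists b, [/\ b \in A, e b v & {in A, forall w, connect (within A e) w b}].
Proof.
move=> vA A0 totA conn_v.
have rev_within B : within B (fun x y => e y x) =2 [rel x y | within B e y x].
  by move=> x y /=; rewrite andbCA.
have [||b [Ab ebv bP]] := @out_neighbour_to_all (fun x y => e y x) A v vA A0.
- by move=> x y Ax Ay; apply: totA.
- by move=> w Aw; rewrite (eq_connect (rev_within _)) connect_rev; apply: conn_v.
exists b; split=> // w /bP.
by rewrite (eq_connect (rev_within _)) connect_rev.
Qed.

(** The rotation moves a failing step to the closing position, so that a bypass through a new vertex
    can be attached at the two ends. *)
Lemma cycle_break r s :
  ~~ cycle r s -> exists i b q, rot i s = b :: q /\ ~~ r (last b q) b.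
Proof.
case: s => [|x p] //=.
have path_break l : ~~ path r x l ->
    exists l1 b l2, l = l1 ++ b :: l2 /\ ~~ r (last x l1) b.
  elim: l x => [|y l IHl] x //=; rewrite negb_and.
  have [rxy /= nl | nrxy _] := boolP (r x y); last by exists [::], y, l.
  have [l1 [b [l2 [-> nr]]]] := IHl y nl.
  by exists (y :: l1), b, l2.
case/path_break=> l1 [b [l2 []]]; case/lastP: l2 => [|l2 z].
  rewrite cats1 => /rcons_inj[-> ->] nr; exists 0, b, l1.
  by rewrite rot0.
rewrite -rcons_cons -rcons_cat => /rcons_inj[-> _] nr.
exists (size (x :: l1)), b, (l2 ++ x :: l1).
by rewrite -[x :: _ ++ _]/((x :: l1) ++ b :: l2) rot_size_cat last_cat.
Qed.

(** Some step of the cycle goes from an in-neighbour of [v] to an out-neighbour, and [v] fits in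
    between. Otherwise, from [x] on, each next vertex is no out-neighbour of [v], hence an
    in-neighbour, and the round trip would never meet [y]. *)
Lemma hamiltonian_insert e A v :
    v \notin A -> {in A, forall x, e x v || e v x} ->
    (exists2 x, x \in A & e x v) -> (exists2 y, y \in A & e v y) ->
  hamiltonian A e -> hamiltonian (v |: A) e.
Proof.
move=> vA adj_v [x Ax exv] [y Ay evy] [s [s_uniq sA s_cyc]].
pose r a b := e a b && ~~ (e a v && e v b).
have /cycle_break[i [b [q [rot_s nr]]]] : ~~ cycle r s.
  apply/negP=> r_cyc; have xs : x \in s by rewrite sA.
  have [i p rot_s] := rot_to xs.
  have mem_p z : z \in x :: p = (z \in A) by rewrite -rot_s mem_rot sA.
  have : y \in rcons p x by rewrite mem_rcons mem_p.
  have: path r x (rcons p x) by move: r_cyc; rewrite -(rot_cycle i) rot_s.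
  have: {subset rcons p x <= A} by move=> z; rewrite mem_rcons mem_p.
  move: (rcons p x) => l; elim: l x Ax exv {rot_s mem_p xs} => // z l IHl x' Ax' ex'v subA /=.
  case/andP=> /andP[_]; rewrite ex'v /= => nevz pzl.
  have Az : z \in A by apply: subA; rewrite mem_head.
  rewrite inE; case: eqP => [yz|_ /=]; first by rewrite yz (negPf nevz) in evy.
  apply: IHl pzl => //; last by move=> w wl; apply: subA; rewrite inE wl orbT.
  by have := adj_v z Az; rewrite (negPf nevz) orbF.
have: cycle e (b :: q) by rewrite -rot_s rot_cycle.
rewrite /= rcons_path => /andP[pbq elast]; move: nr.
rewrite /r elast /= negbK => /andP[elv evb].
have mem_q z : z \in b :: q = (z \in A) by rewrite -rot_s mem_rot sA.
exists (v :: b :: q); split.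
- by rewrite cons_uniq mem_q vA -rot_s rot_uniq.
- by move=> z; rewrite inE mem_q in_setU1.
- by rewrite /= evb rcons_path pbq.
Qed.

(* Choose an out-neighbour a of v reaching all of A and an in-neighbour b reached
   by all of A. If A is not hamiltonian, a hamiltonian cycle of A plus the arc ba
   must use ba, which can then be replaced by the path bva. *)
Lemma hamiltonian_extend e A v :
    v \notin A -> A != set0 -> {in A &, total e} -> strong_on (v |: A) e ->
    (forall f, {in A &, total f} -> strong_on A f -> hamiltonian A f) ->
  hamiltonian A e \/ hamiltonian (v |: A) e.
Proof.
move=> vA A0 totA strA IH.
have vU : v \in v |: A by rewrite setU11.
have AU z : z \in A -> z \in v |: A by move=> Az; rewrite in_setU1 Az orbT.
have [|a [Aa eva aP]] := out_neighbour_to_all vA A0 totA.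
  by move=> w Aw; apply: strA => //; apply: AU.
have [|b [Ab ebv bP]] := in_neighbour_from_all vA A0 totA.
  by move=> w Aw; apply: strA => //; apply: AU.
pose f := [rel x y | e x y || (x == b) && (y == a)].
have [||s [s_uniq sA s_cyc]] := IH f.
- by move=> x y Ax Ay /=; case/orP: (totA x y Ax Ay) => ->; rewrite ?orbT.
- have ef : subrel (connect (within A e)) (connect (within A f)).
    apply: connect_sub => x y /and3P[Ax Ay exy]; apply: connect1.
    by rewrite /= Ax Ay exy.
  move=> x y Ax Ay; apply: connect_trans (ef _ _ (bP x Ax)) _.
  apply: connect_trans (ef _ _ (aP y Ay)); apply: connect1.
  by rewrite /= Aa Ab !eqxx orbT.
have: a \in s by rewrite sA.
case/rot_to=> i p rot_s.
have: cycle f (a :: p) by rewrite -rot_s rot_cycle.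
have mem_p z : z \in a :: p = (z \in A) by rewrite -rot_s mem_rot sA.
have ap_uniq : uniq (a :: p) by rewrite -rot_s rot_uniq.
have [ap _] := andP ap_uniq.
rewrite /= rcons_path => /andP[fap flast].
(* Since [a] starts a duplicate-free sequence, no step inside the path ends in [a]; the added arc
   can only be the closing one. *)
have path_e q : forall x, a \notin q -> path f x q -> path e x q.
  elim: q => //= y q IHq x; rewrite inE negb_or => /andP[ay aq].
  case/andP=> fxy /(IHq _ aq)->; move: fxy.
  by rewrite [y == a]eq_sym (negPf ay) andbF orbF => ->.
have eap := path_e p a ap fap.
have [elast|nelast] := boolP (e (last a p) a).
  left; exists (a :: p); split=> //.
  by rewrite /= rcons_path eap.
right; exists (v :: a :: p); split.
- by rewrite cons_uniq mem_p vA.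
- by move=> z; rewrite inE mem_p in_setU1.
- move: flast; rewrite /= (negPf nelast) eqxx andbT /= => /eqP eb.
  by rewrite eva rcons_path eap /= eb.
Qed.

(* Since [total e] makes e reflexive, one-vertex sets need no exception. *)
Theorem camion e A : {in A &, total e} -> strong_on A e -> hamiltonian A e.
Proof.
have [n] := ubnP #|A|; elim: n e A => // n IHn e A /ltnSE leAn totA strA.
have [->|[v Av]] := set_0Vmem A.
  by exists [::]; split=> // z; rewrite inE.
pose B := A :\ v; have defA : v |: B = A by apply: setD1K.
have vB : v \notin B by rewrite setD11.
have ltBn : #|B| < n by apply: leq_trans leAn; rewrite (cardsD1 v A) Av.
have BA z : z \in B -> z \in A by move/setD1P=> [].
have totB : {in B &, total e} by move=> x y Bx By; apply: totA; apply: BA.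
have [B0|B0] := eqVneq B set0.
  exists [:: v]; split=> //; first by move=> z; rewrite -defA B0 setU0 !inE.
  by rewrite /= andbT; have := totA v v Av Av; rewrite orbb.
have strU : strong_on (v |: B) e by rewrite defA.
have conn z w : z \in A -> w \in A -> connect (within (v |: B) e) z w.
  by rewrite -defA; apply: strU.
have IH f : {in B &, total f} -> strong_on B f -> hamiltonian B f by apply: IHn.
(* If [B] is hamiltonian, totality makes [v] adjacent to all of [B] and strength gives it neighbours
   in both directions, so it can be inserted. *)
have [hamB|] := hamiltonian_extend vB B0 totB strU IH; last by rewrite defA.
rewrite -defA; apply: hamiltonian_insert hamB => //.
- by move=> x Bx; apply: totA (BA x Bx) Av.
- have [|b [Bb ebv _]] := in_neighbour_from_all vB B0 totB; last by exists b.
  by move=> w Bw; apply: conn (BA w Bw) Av.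
- have [|a [Ba eva _]] := out_neighbour_to_all vB B0 totB; last by exists a.
  by move=> w Bw; apply: conn Av (BA w Bw).
Qed.

End HamiltonianCycles.

(** * Closed trails as eulerian subdigraphs *)

Section ClosedTrails.
Variable T : finType.
Implicit Types (e h : rel T) (v x y : T) (p q s : seq T).

Notation arcs := (pairmap pair).

Lemma fst_arcs x p : map fst (arcs x p) = belast x p.
Proof. by elim: p x => //= y p IHp x; rewrite IHp. Qed.

Lemma snd_arcs x p : map snd (arcs x p) = p.
Proof. by elim: p x => //= y p IHp x; rewrite IHp. Qed.

Lemma fst_mem_arcs x p a b : (a, b) \in arcs x p -> a \in belast x p.
Proof. by move/(map_f fst); rewrite fst_arcs. Qed.

Lemma snd_mem_arcs x p a b : (a, b) \in arcs x p -> b \in p.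
Proof. by move/(map_f snd); rewrite snd_arcs. Qed.

Lemma uniq_arcs x p : uniq p -> uniq (arcs x p).
Proof. by rewrite -{1}(snd_arcs x p); apply: map_uniq. Qed.

Lemma uniq_arcs_belast x p : uniq (belast x p) -> uniq (arcs x p).
Proof. by rewrite -fst_arcs; apply: map_uniq. Qed.

Lemma path_all_arcs e x p : path e x p = all (fun a => e a.1 a.2) (arcs x p).
Proof. by elim: p x => //= y p IHp x; rewrite IHp. Qed.

(** As [L] has no repetition, its arcs with tail [x] have distinct heads; degrees along a trail thus
    become multiplicities in its vertex sequence. *)
Lemma outdeg_mem (L : seq (T * T)) x :
  uniq L -> outdeg (fun y z => (y, z) \in L) x = count_mem x (map fst L).
Proof.
move=> uL; rewrite /outdeg count_map -size_filter.
set F := filter _ _; have inF a : a \in F -> a.1 = x.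
  by rewrite mem_filter => /andP[/eqP].
have uF : uniq (map snd F).
  rewrite map_inj_in_uniq ?filter_uniq // => -[a b] [c d] /inF /= -> /inF /= ->.
  by move=> ->.
rewrite -(size_map snd) -(card_uniqP uF); apply: eq_card => z.
rewrite inE; apply/idP/mapP => [xz|[[a b] Fab ->]].
  by exists (x, z); rewrite // mem_filter /= eqxx.
by have /= <- := inF _ Fab; move: Fab; rewrite mem_filter => /andP[].
Qed.

Lemma indeg_mem (L : seq (T * T)) x :
  uniq L -> indeg (fun y z => (y, z) \in L) x = count_mem x (map snd L).
Proof.
move=> uL; pose swap (a : T * T) := (a.2, a.1).
have swapK : involutive swap by case.
rewrite -[LHS]/(outdeg (fun y z => (z, y) \in L) x).
have uL' : uniq (map swap L) by rewrite map_inj_uniq //; apply: inv_inj.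
have -> : map snd L = map fst (map swap L) by rewrite -map_comp.
rewrite -outdeg_mem //; apply: eq_card => z.
rewrite !inE -[(x, z)]/(swap (z, x)) mem_map //; exact: inv_inj.
Qed.

(** The closed trail v, y, q, v repeats no arc, so each visit to a vertex uses up one arc in and one
    arc out. Vertices of [y :: q] may repeat. *)
Lemma closed_trail_eulerian e v y q :
    v \notin y :: q -> (forall x, x != v -> x \in y :: q) ->
    uniq (arcs y q) -> e v y -> path e y q -> e (last y q) v ->
  has_spanning_eulerian e.
Proof.
move=> vq cover uq evy pyq elast.
pose p := rcons (y :: q) v; pose L := arcs v p.
have defL : L = (v, y) :: rcons (arcs y q) (last y q, v).
  by rewrite /L /p /= -cats1 pairmap_cat cats1.
have uL : uniq L.
  rewrite defL /= mem_rcons inE rcons_uniq uq andbT negb_or xpair_eqE.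
  (* As [v] lies outside [y :: q], it is a tail only in the first arc and a head only in the
     last. *)
  apply/andP; split; first (apply/andP; split).
  - by apply: contra vq => /andP[_ /eqP<-]; rewrite mem_head.
  - by apply: contra vq => /fst_mem_arcs; apply: mem_belast.
  - by apply: contra vq => /snd_mem_arcs qv; rewrite inE qv orbT.
pose h x z := (x, z) \in L.
have ph : path h v p by rewrite path_all_arcs; apply/allP => -[].
have pe : path e v p by rewrite /p /= evy rcons_path pyq.
exists h; split; [|split].
- by move=> x z; move: pe; rewrite path_all_arcs => /allP/[apply].
- have sym : connect_sym (adjacent h).
    by apply: sym_connect_sym => x z; apply: orbC.
  have conn x : connect (adjacent h) v x.
    have sub : subrel (connect h) (connect (adjacent h)).
      by apply: connect_sub => a b hab; apply: connect1; apply/orP; left.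
    apply: sub; apply: (path_connect ph).
    have [->|/cover xq] := eqVneq x v; first exact: mem_head.
    by rewrite inE mem_rcons inE xq !orbT.
  by move=> x z; apply: connect_trans (conn z); rewrite sym.
- move=> x; rewrite indeg_mem // outdeg_mem // fst_arcs snd_arcs.
  (* Tails are listed by [v :: y :: q] and heads by its rotation, hence with equal
     multiplicities. *)
  by rewrite /p belast_rcons; apply/permP; rewrite perm_rcons.
Qed.

End ClosedTrails.

(** Camion's theorem is applied to a reflexive closure; the absence of repetitions removes the added
    loops. *)
Lemma uniq_path_reflexive (T : eqType) (e : rel T) x p :
  uniq (x :: p) -> path [rel a b | (a == b) || e a b] x p -> path e x p.
Proof.
elim: p x => //= y p IHp x /andP[]; rewrite inE negb_or => /andP[nxy _] uyp.
by case/andP; rewrite (negPf nxy) /= => -> /(IHp _ uyp).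
Qed.

Lemma sorted_split (T : eqType) (P : pred T) p :
    sorted [rel a b | P b ==> P a] p ->
  exists p1 p2, [/\ p = p1 ++ p2, all P p1 & all (predC P) p2].
Proof.
elim: p => [|y p IHp] /=; first by exists [::], [::].
move=> pyp; have [Py|nPy] := boolP (P y).
  have [p1 [p2 [-> Pp1 Pp2]]] := IHp (path_sorted pyp).
  by exists (y :: p1), p2; rewrite /= Py.
exists [::], (y :: p); split; rewrite //= nPy /=.
elim: p y nPy pyp {IHp} => //= z p IHp y nPy.
by rewrite (negPf nPy) implybF => /andP[nPz /(IHp _ nPz)->]; rewrite nPz.
Qed.

(** * From the absence of a spanning eulerian subdigraph to the partition *)

Section CycleMissingOneVertex.
Variables (T : finType) (e : rel T) (u v : T) (p : seq T).
Hypothesis irr_e : irreflexive e.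
Hypotheses (euv : ~~ e u v) (evu : ~~ e v u).
Hypothesis adj_v : forall x, x != u -> x != v -> e x v || e v x.
Hypotheses (up_uniq : uniq (u :: p)) (mem_up : forall x, (x \in u :: p) = (x != v)).
Hypotheses (e_up : path e u p) (e_last : e (last u p) u).
Hypotheses (v_out : exists x, e v x) (v_in : exists x, e x v).

Lemma obstruction_of_not_eulerian :
  ~ has_spanning_eulerian e ->
  exists R1 R2 : {set T}, let Y := [set u; v] in
     [/\ partition3 R1 R2 Y,
         independent e Y,
         arcs_between e R2 Y = 0,
         arcs_between e Y R1 = 0
       & arcs_between e R2 R1 = 1].
Proof.
move=> not_eul.
have nev x : e v x -> x != v by apply: contraTneq => ->; rewrite irr_e.
have nev' x : e x v -> x != v by apply: contraTneq => ->; rewrite irr_e.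
have neu x : e v x -> x != u by apply: contraTneq => ->.
have neu' x : e x v -> x != u by apply: contraTneq => ->.
have up_cyc : cycle e (u :: p) by rewrite /= rcons_path e_up.
have rot_up i x q : rot i (u :: p) = x :: q ->
    [/\ uniq (x :: q), path e x q, e (last x q) x
      & forall z, (z \in x :: q) = (z != v)].
  move=> rot_x; move: (up_cyc) (up_uniq); rewrite -(rot_cycle i) -(rot_uniq i) rot_x.
  rewrite /= rcons_path => /andP[-> ->] ->; split=> // z.
  by rewrite -rot_x mem_rot.
(* Trail: v, x, all of C back to x, v. *)
have in_not_out x : e x v -> ~~ e v x.
  move=> exv; apply/negP=> evx; apply: not_eul.
  have: x \in u :: p by rewrite mem_up nev.
  case/rot_to=> i q /rot_up[uxq pxq elast mem_xq].
  apply: (@closed_trail_eulerian _ _ v x (rcons q x)).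
  - by rewrite inE mem_rcons inE orbA orbb -in_cons mem_xq negbK.
  - by move=> z; rewrite inE mem_rcons inE orbA orbb -in_cons mem_xq.
  - by apply: uniq_arcs; rewrite rcons_uniq.
  - by [].
  - by rewrite rcons_path pxq.
  - by rewrite last_rcons.
(* A step of C from an in-neighbour to an out-neighbour of [v] could be rerouted through [v], giving
   a hamiltonian cycle. *)
have no_step : cycle [rel a b | ~~ (e a v && e v b)] (u :: p).
  apply/negPn/negP=> /cycle_break[i [b [q [/rot_up[ubq pbq _ mem_bq]]]]].
  rewrite /= negbK => /andP[elv evb]; apply: not_eul.
  apply: (@closed_trail_eulerian _ _ v b q) => //.
  - by rewrite mem_bq negbK.
  - by move=> z; rewrite mem_bq.
  - by apply: uniq_arcs; case/andP: ubq.
have mem_p x : (x \in p) = (x != u) && (x != v).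
  rewrite -mem_up inE; case: eqP => [->|//] /=.
  by case/andP: up_uniq => /negPf.
have inE_p x : x \in p -> e x v = ~~ e v x.
  rewrite mem_p => /andP[xu xv]; have [/in_not_out//|exv] := boolP (e x v).
  by have := adj_v xu xv; rewrite (negPf exv) /= => ->.
(* On [p] the in-neighbours of [v] are exactly its non-out-neighbours, so [no_step] says that no
   out-neighbour directly follows a non-out-neighbour. *)
have [p1 [p2 [defp out1 in2]]] : exists p1 p2,
    [/\ p = p1 ++ p2, all (e v) p1 & all (predC (e v)) p2].
  apply: sorted_split.
  apply: (@sub_in_sorted _ [in p] [rel a b | ~~ (e a v && e v b)]).
  - by move=> a b /inE_p /= -> _; rewrite negb_and negbK orbC implybE.
  - exact/allP.
  - by move: no_step; rewrite /= rcons_path => /andP[/path_sorted].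
have {}out1 x : x \in p1 -> e v x by move/(allP out1).
have {}in2 x : x \in p2 -> e x v.
  by move=> p2x; rewrite inE_p ?defp ?mem_cat ?p2x ?orbT //; apply: (allP in2).
have mem_p1 x : (x \in p1) = e v x.
  apply/idP/idP => [|evx]; first exact: out1.
  have : x \in p by rewrite mem_p neu ?nev.
  by rewrite defp mem_cat => /orP[//|/in2/in_not_out]; rewrite evx.
have mem_p2 x : (x \in p2) = e x v.
  apply/idP/idP => [|exv]; first exact: in2.
  have : x \in p by rewrite mem_p neu' ?nev'.
  rewrite defp mem_cat => /orP[/out1|//].
  by rewrite (negPf (in_not_out x exv)).
have [c [p1' defp1]] : exists c p1', p1 = c :: p1'.
  case: v_out => x; rewrite -mem_p1; case: (p1) => // c p1' _.
  by exists c, p1'.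
have [d [p2' defp2]] : exists d p2', p2 = d :: p2'.
  case: v_in => x; rewrite -mem_p2; case: (p2) => // d p2' _.
  by exists d, p2'.
have [up_notin p_uniq] := andP up_uniq.
(* Trail: v, x, u, p, v. *)
have no_out_u x : e v x -> ~~ e x u.
  move=> evx; apply/negP=> exu; apply: not_eul.
  apply: (@closed_trail_eulerian _ _ v x (u :: p)) => //.
  - by rewrite in_cons mem_up eqxx orbF eq_sym nev.
  - by move=> z zv; rewrite in_cons mem_up zv orbT.
  - exact: uniq_arcs.
  - by rewrite /= exu.
  - rewrite /= -mem_p2 defp last_cat defp2 /=; exact: mem_last.
(* Trail: v, p, u, y, v. *)
have no_u_in y : e y v -> ~~ e u y.
  move=> eyv; apply/negP=> euy; apply: not_eul.
  have defcp : p = c :: (p1' ++ p2) by rewrite defp defp1.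
  have mem_q z : z \in c :: rcons (rcons (p1' ++ p2) u) y = (z == y) || (z != v).
    by rewrite -mem_up -!rcons_cons -defcp !mem_rcons !in_cons mem_rcons in_cons.
  apply: (@closed_trail_eulerian _ _ v c (rcons (rcons (p1' ++ p2) u) y)).
  - by rewrite mem_q eqxx orbF eq_sym nev'.
  - by move=> z zv; rewrite mem_q zv orbT.
  (* The vertex [y] is a head twice, within [p2] and at the end, so distinctness is read off the
     tails. *)
  - by apply: uniq_arcs_belast; rewrite belast_rcons -rcons_cons -defcp rcons_uniq.
  - by rewrite -mem_p1 defp1 mem_head.
  - move: up_cyc; rewrite defcp /= => /andP[_].
    by rewrite [path _ _ (rcons (rcons _ _) _)]rcons_path last_rcons euy => ->.
  - by rewrite last_rcons.
(* Trail: v, x, y, all of C back to y, v; its arcs are distinct unless xy lies on C. *)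
have cross x y : e v x -> e y v -> e x y -> x = last u p1 /\ y = d.
  move=> evx eyv exy; have : y \in p2 by rewrite mem_p2.
  case/splitPr def2: {-}p2 / => [m1 m2].
  have /rot_up[uq pq elast mem_q] :
      rot (size (u :: p1 ++ m1)) (u :: p) = y :: m2 ++ u :: p1 ++ m1.
    by rewrite defp def2 catA -cat_cons rot_size_cat.
  have x_last : x = last u (p1 ++ m1).
    apply/eqP/negPn/negP=> x_last; apply: not_eul.
    pose q := rcons (m2 ++ u :: p1 ++ m1) y.
    have mem_yq z : z \in y :: q = (z != v).
      by rewrite inE mem_rcons inE orbA orbb -in_cons mem_q.
    apply: (@closed_trail_eulerian _ _ v x (y :: q)) => //.
    + by rewrite inE mem_yq eqxx orbF eq_sym nev.
    + by move=> z zv; rewrite inE mem_yq zv orbT.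
    (* In [q] the vertex [y] occurs only at the end, so [xy] could be repeated only as the closing
       arc, which [x_last] excludes. *)
    + rewrite /= uniq_arcs ?rcons_uniq // andbT /q -cats1 pairmap_cat mem_cat negb_or.
      apply/andP; split.
        by apply: contraTN uq => /snd_mem_arcs /= ->.
      by rewrite /= inE xpair_eqE eqxx andbT last_cat.
    + by rewrite /= exy rcons_path pq.
    + by rewrite /= last_rcons.
  (* Here [m1] is the part of [p2] before [y]. If it is empty, [y] is [d] and [x] is [last u p1];
     otherwise [x] lies in [p2], impossible for an out-neighbour of [v]. *)
  case/lastP: m1 def2 x_last {uq pq elast mem_q} => [|m1 z] def2 x_last.
    by rewrite x_last cats0; move: def2; rewrite defp2 => -[].
  move: x_last; rewrite last_cat last_rcons => xz.
  have /in2/in_not_out : x \in p2 by rewrite def2 mem_cat mem_rcons xz mem_head.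
  by rewrite evx.
exists [set x | e x v], [set x | e v x]; split.
- split.
  + rewrite disjoints_subset; apply/subsetP=> x.
    by rewrite !inE => /in_not_out.
  + rewrite disjoints_subset; apply/subsetP=> x.
    by rewrite !inE => exv; rewrite negb_or neu' ?nev'.
  + rewrite disjoints_subset; apply/subsetP=> x.
    by rewrite !inE => evx; rewrite negb_or neu ?nev.
  + apply/setP=> x; rewrite !inE; have [_|xu] := eqVneq x u; first by rewrite orbT.
    have [_|xv] := eqVneq x v; first by rewrite !orbT.
    by rewrite adj_v.
- have nuv : ~~ adjacent e u v by rewrite /= negb_or euv.
  have nvu : ~~ adjacent e v u by rewrite /= negb_or evu.
  by move=> x y; rewrite !inE => /orP[]/eqP-> /orP[]/eqP-> //; rewrite eqxx.
- apply/eqP; rewrite cards_eq0; apply/eqP/setP=> -[a b]; rewrite !inE /=.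
  apply/negP=> /and3P[eva /orP[]/eqP-> ]; first by rewrite (negPf (no_out_u a eva)).
  by move=> /in_not_out; rewrite eva.
- apply/eqP; rewrite cards_eq0; apply/eqP/setP=> -[a b]; rewrite !inE /=.
  apply/negP=> /and3P[/orP[]/eqP-> ebv]; first by rewrite (negPf (no_u_in b ebv)).
  by rewrite (negPf (in_not_out b ebv)).
- rewrite /arcs_between (_ : [set a | _] = [set (last u p1, d)]) ?cards1 //.
  apply/setP=> -[a b]; rewrite !inE /= xpair_eqE.
  apply/and3P/andP => [[eva ebv eab]|[/eqP-> /eqP->]].
    by have [-> ->] := cross a b eva ebv eab.
  split; first by rewrite -mem_p1 defp1; apply: (mem_last c).
    by rewrite -mem_p2 defp2 mem_head.
  by move: e_up; rewrite defp defp2 cat_path /= => /and3P[].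
Qed.

End CycleMissingOneVertex.

(** * From the partition to the absence of a spanning eulerian subdigraph *)

Section Obstruction.
Variable T : finType.
Implicit Types (e h : rel T) (X Z : {set T}).

Lemma connect_first e x y : connect e x y -> x != y -> exists z, e x z.
Proof.
case/connectP=> -[|z p] /=; first by move=> _ ->; rewrite eqxx.
by case/andP; exists z.
Qed.

Lemma arcs_betweenE e X Z :
  arcs_between e X Z = \sum_(x in X) \sum_(y in Z) e x y.
Proof.
rewrite pair_big /arcs_between -sum1_card big_mkcond [RHS]big_mkcond.
apply: eq_bigr => -[x y] _; rewrite inE /= andbA.
by case: (e x y); rewrite ?andbT ?andbF //; case: ifP.
Qed.

(** Adding the arcs inside [X] to both sides turns them into the sums of out-degrees and of
    in-degrees over [X]. *)
Lemma eulerian_cut h X :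
  eulerian h -> arcs_between h X (~: X) = arcs_between h (~: X) X.
Proof.
case=> _ bal_h; rewrite !arcs_betweenE [RHS]exchange_big /=.
apply: (@addnI (\sum_(x in X) \sum_(y in X) h x y)).
rewrite [X in _ = X + _]exchange_big -!big_split /=; apply: eq_bigr => x _.
have deg_split (g : pred T) : \sum_(y in X) g y + \sum_(y in ~: X) g y = #|[set y | g y]|.
  rewrite -sum1_card [RHS]big_mkcond [RHS](bigID [in X]) /=; congr (_ + _).
    by apply: eq_bigr => y _; rewrite inE; case: (g y).
  by apply: eq_big => y; [rewrite inE | rewrite inE; case: (g y)].
by rewrite (deg_split (h x)) (deg_split (h^~ x)); apply/esym/bal_h.
Qed.

(** Connectedness gives [x] an incident arc; if that arc enters [x], balance supplies one that
    leaves. *)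
Lemma eulerian_out h x y : eulerian h -> x != y -> exists z, h x z.
Proof.
case=> conn_h bal_h xy; have [z /orP[hxz|hzx]] := connect_first (conn_h x y) xy.
  by exists z.
have: 0 < outdeg h x by rewrite -bal_h; apply/card_gt0P; exists z; rewrite inE.
by case/card_gt0P=> w; rewrite inE => hxw; exists w.
Qed.

Lemma arcs_between0 e X Z x y :
  arcs_between e X Z = 0 -> x \in X -> y \in Z -> e x y = false.
Proof.
move/eqP; rewrite cards_eq0 => /eqP/setP/(_ (x, y)); rewrite !inE /= => XZ0 Xx Zy.
by rewrite Xx Zy in XZ0.
Qed.

Lemma obstruction_not_eulerian e u v R1 R2 (Y := [set u; v]) :
    irreflexive e -> u != v -> partition3 R1 R2 Y -> independent e Y ->
    arcs_between e R2 Y = 0 -> arcs_between e Y R1 = 0 ->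
    arcs_between e R2 R1 = 1 ->
  ~ has_spanning_eulerian e.
Proof.
move=> irr_e uv [_ _ R2Y cover] indY noR2Y noYR1 oneR2R1 [h [he eul_h]].
have coverP x : [|| x \in R1, x \in R2 | x \in Y].
  by have := in_setT x; rewrite -cover !in_setU -orbA.
have Yu : u \in Y by rewrite !inE eqxx.
have Yv : v \in Y by rewrite !inE eqxx orbT.
(* An arc of [h] leaving [R2] cannot end in [Y], so it is the single arc from [R2] to [R1]. *)
have out_leq1 : arcs_between h R2 (~: R2) <= 1.
  rewrite -oneR2R1; apply/subset_leq_card/subsetP=> -[a b]; rewrite !inE /=.
  case/and3P=> R2a nR2b /he eab; rewrite R2a eab andbT /=.
  case/or3P: (coverP b) => // [R2b|Yb]; first by rewrite R2b in nR2b.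
  by rewrite (arcs_between0 noR2Y) in eab.
have Y_out y z : y \in Y -> y != z -> exists2 w, w \in R2 & h y w.
  move=> Yy yz; have [w hyw] := eulerian_out eul_h yz; exists w => //.
  have eyw := he _ _ hyw.
  case/or3P: (coverP w) => // [R1w|Yw]; first by rewrite (arcs_between0 noYR1) in eyw.
  have [yw|nyw] := eqVneq y w; first by rewrite yw irr_e in eyw.
  by case/negP: (indY y w Yy Yw nyw); apply/orP; left.
have [w R2w huw] := Y_out u v Yu uv.
have [w' R2w' hvw'] : exists2 w', w' \in R2 & h v w'.
  by apply: (Y_out v u Yv); rewrite eq_sym.
move: out_leq1; rewrite eulerian_cut // leqNgt => /negP; apply.
have notR2 y : y \in Y -> y \notin R2 by move=> Yy; rewrite (disjointFl R2Y Yy).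
rewrite (_ : 1 < _ = (#|[set (u, w); (v, w')]| <= arcs_between h (~: R2) R2)); last first.
  by rewrite cards2 xpair_eqE (negPf uv).
apply/subset_leq_card/subsetP=> a; rewrite !inE => /orP[]/eqP-> /=.
  by rewrite notR2 // R2w.
by rewrite notR2 // R2w'.
Qed.

End Obstruction.

Theorem theorem36 (T : finType) (D : rel T) (u v : T) :
  irreflexive D -> semicomplete D -> D u v ->
  let D' := del_arc D u v in
  strong D' ->
  (has_spanning_eulerian D' <->
   ~ exists R1 R2 : {set T}, let Y := [set u; v] in
     [/\ partition3 R1 R2 Y,
         independent D' Y,
         arcs_between D' R2 Y = 0,
         arcs_between D' Y R1 = 0
       & arcs_between D' R2 R1 = 1]).
Proof.
move=> irrD semD Duv e str_e.
have uv : u != v by apply: contraTneq Duv => ->; rewrite irrD.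
have eE x y : e x y = D x y && ((x, y) != (u, v)) by [].
have irr_e : irreflexive e by move=> x; rewrite !eE irrD.
split.
  move=> eul [R1 [R2 [parts indY R2Y YR1 R2R1]]].
  exact: (obstruction_not_eulerian irr_e uv parts).
move=> no_obstruction.
have euv : ~~ e u v by rewrite !eE eqxx andbF.
have adj_e x : x != u -> x != v -> e x v || e v x.
  move=> xu xv; have := semD x v xv; rewrite /adjacent /= !eE !xpair_eqE.
  by rewrite (negPf xu) [v == u]eq_sym (negPf uv) /= !andbT.
pose f := [rel x y | (x == y) || e x y].
have tot_f : {in ~: [set v] &, total f}.
  move=> x y; rewrite !inE => xv yv.
  have [->|nxy] := eqVneq x y; first by rewrite /f /= eqxx.
  suff adj_xy : e x y || e y x.
    by case/orP: adj_xy => exy; apply/orP; [left | right]; apply/orP; right.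
  (* The deleted arc ends in [v], so it joins no two vertices other than [v]. *)
  rewrite !eE !xpair_eqE (negPf xv) (negPf yv) !andbF !andbT.
  exact: semD nxy.
have vA : v \notin ~: [set v] by rewrite !inE eqxx.
have A0 : ~: [set v] != set0 by apply/set0Pn; exists u; rewrite !inE.
have defT : v |: ~: [set v] = setT by rewrite setUCr.
have str_f : strong_on (v |: ~: [set v]) f.
  move=> x y _ _; have [->|/str_e] := eqVneq x y; first exact: connect0.
  apply: connect_sub => a b eab; apply: connect1.
  by apply/and3P; split; rewrite ?defT ?inE //; apply/orP; right.
have eul_ham : hamiltonian setT f -> has_spanning_eulerian e.
  move=> [s [s_uniq sT s_cyc]].
  have: v \in s by rewrite sT in_setT.
  case/rot_to=> i [|y q] rot_s.
    have: u \in s by rewrite sT in_setT.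
    by rewrite -(mem_rot i) rot_s inE (negPf uv).
  move: s_uniq s_cyc; rewrite -(rot_uniq i) -(rot_cycle i) rot_s.
  move=> /andP[vq yq_uniq] /= /andP[fvy]; rewrite rcons_path => /andP[fyq flast].
  apply: (@closed_trail_eulerian _ _ v y q) => //.
  - by move=> x xv; have := sT x; rewrite -(mem_rot i) rot_s !inE (negPf xv).
  - by apply: uniq_arcs; case/andP: yq_uniq.
  - by case/orP: fvy => // /eqP vy; rewrite vy mem_head in vq.
  - exact: uniq_path_reflexive.
  - by case/orP: flast => // /eqP lv; rewrite -lv mem_last in vq.
have [ham_v|] := hamiltonian_extend vA A0 tot_f str_f (@camion _ ^~ _); last first.
  by rewrite defT; apply: eul_ham.
have [x evx] : exists x, e v x by apply: connect_first (str_e v u _) _; rewrite eq_sym.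
have [x' ex'v] : exists x, e x v.
  have := str_e u v uv; have /= <- := connect_rev e v u.
  by move/connect_first; apply; rewrite eq_sym.
have nev y : e v y || e y v -> y != v by apply: contraTneq => ->; rewrite irr_e.
(* If [vu] is an arc of [D'], then [v] is adjacent to every other vertex and can be inserted. *)
have [evu|nevu] := boolP (e v u).
  apply: eul_ham; rewrite -defT; apply: hamiltonian_insert ham_v => //.
  - move=> y; rewrite !inE => yv /=; rewrite (negPf yv) eq_sym (negPf yv) /=.
    by have [->|yu] := eqVneq y u; [rewrite evu orbT | apply: adj_e].
  - by exists x'; rewrite ?inE ?nev /= ?ex'v ?orbT.
  - by exists x; rewrite ?inE ?nev /= ?evx ?orbT.
have [s [s_uniq sA s_cyc]] := ham_v.
have: u \in s by rewrite sA !inE.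
case/rot_to=> i p rot_s.
have mem_up z : (z \in u :: p) = (z != v) by rewrite -rot_s mem_rot sA !inE.
have up_uniq : uniq (u :: p) by rewrite -rot_s rot_uniq.
move: s_cyc; rewrite -(rot_cycle i) rot_s /= rcons_path => /andP[fup flast].
apply: NNPP => not_eul; apply: no_obstruction.
apply: (obstruction_of_not_eulerian (p := p)) => //.
- exact: uniq_path_reflexive.
(* The closing step of [f] might be an equality: with [p] empty the out-neighbour [x] of [v] would
   be [u], and otherwise [u] would occur in [p]. *)
- case: p mem_up up_uniq flast {rot_s fup} => [|c p] mem_up up_uniq /=.
    have: x \in [:: u] by rewrite mem_up nev ?evx.
    by rewrite inE => /eqP xu; rewrite xu (negPf nevu) in evx.
  case/orP=> // /eqP lu; case/andP: up_uniq; rewrite -lu /=.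
  by rewrite mem_last.
- by exists x.
- by exists x'.
Qed.
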